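(* Let $\Gamma=\mathbb{R}^n$, let $G$ be a finite permutation group on the coordinates of $\Gamma$, and let $\Lambda$ be a $G$-lattice in $\Gamma$. For any subgroup $H$ of $G$, with $\Lambda_0:=\{v\in\Lambda : v\theta_H\in\Lambda\}$, one has $$(\Lambda_0\theta_H)^{*} = \ker\theta_H \oplus (\Lambda_0)^{*}\theta_H .$$
   Context: $\langle u,v\rangle=\sum_{i}u_iv_i$ is the standard inner product on $\mathbb{R}^n$. A lattice in $\mathbb{R}^n$ is the $\mathbb{Z}$-span of an $\mathbb{R}$-basis of $\mathbb{R}^n$. A permutation group $G$ on $\{1,\dots,n\}$ acts on $\Gamma=\mathbb{R}^n$ on the right by $(vg)_i=v_{ig^{-1}}$. A $G$-lattice is a lattice $\Lambda\subseteq\Gamma$ with $\Lambda g\subseteq\Lambda$ for all $g\in G$. For a subgroup $H\le G$, $\theta_H:=\frac{1}{|H|}\sum_{h\in H}h$, acting by $v\theta_H=\frac1{|H|}\sum_{h\in H}vh$; $X\theta_H:=\{v\theta_H:v\in X\}$ and $\ker\theta_H=\{v\in\Gamma:v\theta_H=0\}$. For a subset $X\subseteq\mathbb{R}^n$ (in particular for $\Lambda_0$ and for $\Lambda_0\theta_H$, which need not have rank $n$), $X^{*}:=\{u\in\mathbb{R}^n:\langle u,v\rangle\in\mathbb{Z}\text{ for all }v\in X\}$. The sum is an internal direct sum of additive subgroups of $\mathbb{R}^n$. *)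

(* Defs.v *)
From HB Require Import structures.
From mathcomp Require Import all_boot all_order all_fingroup all_algebra.
From mathcomp Require Import boolp classical_sets reals.

Set Implicit Arguments.
Unset Strict Implicit.
Unset Printing Implicit Defensive.

Import Order.TTheory GRing.Theory Num.Theory.

Local Open Scope classical_set_scope.
Local Open Scope ring_scope.

Definition dot (R : realType) (n : nat) (u v : 'rV[R]_n) : R :=
  \sum_(i < n) u ord0 i * v ord0 i.

Definition is_lattice (R : realType) (n : nat) (L : set 'rV[R]_n) : Prop :=
  exists2 b : n.-tuple 'rV[R]_n,
    basis_of fullv b & L = [set v | inIntSpan b v].

(* Permutations compose left to right, (g * h)%g i = h (g i), so this is a
   right action. *)
Definition pact (R : realType) (n : nat) (v : 'rV[R]_n) (g : 'S_n) : 'rV[R]_n :=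
  \row_(i < n) v ord0 ((g^-1)%g i).

Definition is_Glattice (R : realType) (n : nat) (G : {group 'S_n})
    (L : set 'rV[R]_n) : Prop :=
  is_lattice L /\ forall g, g \in G -> [set pact v g | v in L] `<=` L.

Definition theta (R : realType) (n : nat) (H : {group 'S_n}) (v : 'rV[R]_n) :
    'rV[R]_n :=
  #|H|%:R^-1 *: \sum_(h in H) pact v h.

Definition ker_theta (R : realType) (n : nat) (H : {group 'S_n}) :
    set 'rV[R]_n :=
  [set v | theta H v = 0].

(* The dual is taken in the whole of R^n, not in the linear span of X, so it
   contains the orthogonal complement of X. *)
Definition dual (R : realType) (n : nat) (X : set 'rV[R]_n) : set 'rV[R]_n :=
  [set u | forall v, X v -> dot u v \is a Num.int].

Definition Lambda0 (R : realType) (n : nat) (H : {group 'S_n})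
    (L : set 'rV[R]_n) : set 'rV[R]_n :=
  [set v | L v /\ L (theta H v)].

Definition internal_direct_sum (V : zmodType) (A B C : set V) : Prop :=
  [/\ zmod_closed [in B], zmod_closed [in C],
      A = [set b + c | b in B & c in C] & B `&` C = [set 0]].

(* Main.v *)
(* The averaging operator theta_H is an orthogonal projection, i.e. idempotent
   and self-adjoint.  Self-adjointness says that u lies in the dual of
   Lambda_0 theta_H iff u theta_H lies in the dual of Lambda_0, so that
   u = (u - u theta_H) + u theta_H is the required decomposition; the converse
   inclusion uses that idempotence makes Lambda_0 stable under theta_H. *)
Require Import Defs.
From mathcomp Require Import all_boot all_order all_fingroup all_algebra.
From mathcomp Require Import boolp classical_sets reals.

Import GRing.Theory Num.Theory.

Local Open Scope classical_set_scope.
Local Open Scope ring_scope.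

Lemma dotE (R : realType) (n : nat) (u v : 'rV[R]_n) :
  dot u v = (u *m v^T) 0 0.
Proof. by rewrite mxE; apply: eq_bigr => i _; rewrite mxE. Qed.

Lemma dotBl (R : realType) (n : nat) (u w v : 'rV[R]_n) :
  dot (u - w) v = dot u v - dot w v.
Proof. by rewrite !dotE mulmxBl !mxE. Qed.

Lemma pactE (R : realType) (n : nat) (v : 'rV[R]_n) (g : 'S_n) :
  pact v g = v *m perm_mx g.
Proof.
(* Right multiplication by [perm_mx s^-1] is [col_perm s], so [g] is first written as a double
   inverse. *)
rewrite -[g in RHS]invgK -col_permE.
by apply/rowP => i; rewrite !mxE.
Qed.

(** In matrix form, idempotence and self-adjointness become identities between products and
    transposes. *)
Definition theta_mx (R : realType) {n : nat} (H : {group 'S_n}) : 'M[R]_n :=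
  #|H|%:R^-1 *: \sum_(h in H) perm_mx h.

Lemma thetaE (R : realType) (n : nat) (H : {group 'S_n}) (v : 'rV[R]_n) :
  theta H v = v *m theta_mx R H.
Proof.
rewrite /theta /theta_mx -scalemxAr mulmx_sumr; congr (_ *: _).
by apply: eq_bigr => h _; rewrite pactE.
Qed.

(** Left translation by [h] permutes [H], hence only reorders the sum. *)
Lemma perm_mx_theta (R : realType) (n : nat) (H : {group 'S_n}) (h : 'S_n) :
  h \in H -> perm_mx h *m theta_mx R H = theta_mx R H.
Proof.
move=> hH; rewrite /theta_mx -scalemxAr mulmx_sumr; congr (_ *: _).
rewrite [RHS](reindex_inj (mulgI h)); apply: eq_big => [k|k _].
  by rewrite groupMl.
by rewrite perm_mxM.
Qed.

Lemma theta_mx_idem (R : realType) (n : nat) (H : {group 'S_n}) :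
  theta_mx R H *m theta_mx R H = theta_mx R H.
Proof.
rewrite {1}/theta_mx -scalemxAl mulmx_suml.
under eq_bigr => h hH do rewrite perm_mx_theta //.
rewrite sumr_const -scaler_nat scalerA mulVf ?scale1r //.
by rewrite pnatr_eq0 -lt0n cardG_gt0.
Qed.

(** Transposing a permutation matrix inverts the permutation, and inversion permutes [H]. *)
Lemma tr_theta_mx (R : realType) (n : nat) (H : {group 'S_n}) :
  (theta_mx R H)^T = theta_mx R H.
Proof.
rewrite /theta_mx linearZ linear_sum /=; congr (_ *: _).
rewrite [RHS](reindex_inj invg_inj); apply: eq_big => [k|k _].
  by rewrite groupV.
by rewrite tr_perm_mx.
Qed.

Lemma theta0 (R : realType) (n : nat) (H : {group 'S_n}) :
  theta H (0 : 'rV[R]_n) = 0.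
Proof. by rewrite thetaE mul0mx. Qed.

Lemma thetaB (R : realType) (n : nat) (H : {group 'S_n}) (u v : 'rV[R]_n) :
  theta H (u - v) = theta H u - theta H v.
Proof. by rewrite !thetaE mulmxBl. Qed.

Lemma thetaD (R : realType) (n : nat) (H : {group 'S_n}) (u v : 'rV[R]_n) :
  theta H (u + v) = theta H u + theta H v.
Proof. by rewrite !thetaE mulmxDl. Qed.

Lemma theta_idem (R : realType) (n : nat) (H : {group 'S_n}) (v : 'rV[R]_n) :
  theta H (theta H v) = theta H v.
Proof. by rewrite !thetaE -mulmxA theta_mx_idem. Qed.

Lemma dot_theta (R : realType) (n : nat) (H : {group 'S_n}) (u v : 'rV[R]_n) :
  dot (theta H u) v = dot u (theta H v).
Proof. by rewrite !dotE !thetaE trmx_mul tr_theta_mx mulmxA. Qed.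

Lemma dual0 (R : realType) (n : nat) (X : set 'rV[R]_n) : dual X 0.
Proof. by move=> v _; rewrite dotE mul0mx mxE rpred0. Qed.

Lemma dualB (R : realType) (n : nat) (X : set 'rV[R]_n) (u w : 'rV[R]_n) :
  dual X u -> dual X w -> dual X (u - w).
Proof. by move=> uX wX v vX; rewrite dotBl rpredB ?uX ?wX. Qed.

Lemma dual_theta_image (R : realType) (n : nat) (H : {group 'S_n})
    (X : set 'rV[R]_n) (u : 'rV[R]_n) :
  dual (theta H @` X) u <-> dual X (theta H u).
Proof.
split=> [uX v vX | uX _ [v vX <-]]; last by rewrite -dot_theta; apply: uX.
by rewrite dot_theta; apply: uX; exists v.
Qed.

Lemma Lambda0_theta (R : realType) (n : nat) (H : {group 'S_n})
    (L : set 'rV[R]_n) (v : 'rV[R]_n) :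
  Lambda0 H L v -> Lambda0 H L (theta H v).
Proof. by case=> _ Lv; split; rewrite ?theta_idem. Qed.

Theorem theorem4p1 (R : realType) (n : nat) (G : {group 'S_n})
    (L : set 'rV[R]_n) (hL : is_Glattice G L)
    (H : {group 'S_n}) (hHG : H \subset G) :
  internal_direct_sum (dual (theta H @` Lambda0 H L))
    (ker_theta H) (theta H @` dual (Lambda0 H L)).
Proof.
split.
- split=> [|u v]; rewrite !inE /ker_theta /=; first exact: theta0.
  by rewrite thetaB => -> ->; rewrite subr0.
- split=> [|_ _ /set_mem[u uD <-] /set_mem[w wD <-]]; rewrite inE.
    by exists 0; [exact: dual0 | exact: theta0].
  by exists (u - w); [exact: dualB | exact: thetaB].
- apply/seteqP; split=> [u /dual_theta_image uD | _ [b bK [_ [w wD <-] <-]]].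
    exists (u - theta H u); first by rewrite /ker_theta /= thetaB theta_idem subrr.
    exists (theta H u); last exact: subrK.
    (* [theta H u] is its own preimage: it lies in the dual by [uD] and is fixed by the
       projection. *)
    by exists (theta H u) => //; rewrite theta_idem.
  apply/dual_theta_image => v vL.
  (* The kernel part [b] vanishes, and the projection moves from [w] to [v], which stays in
     [Lambda0 H L]. *)
  rewrite thetaD bK add0r theta_idem dot_theta.
  by apply: wD; apply: Lambda0_theta.
(* A vector in the intersection is both fixed and killed by the projection, hence zero. *)
- apply/seteqP; split=> [_ [/[swap] [[w _ <-]]] | _ ->].
    by rewrite /ker_theta /= theta_idem.
  by split; [exact: theta0 | exists 0; [exact: dual0 | exact: theta0]].
Qed.
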